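(* Let $H$ be a Hopf algebra over $\mathbb{C}$ with invertible antipode, equipped with a left covariant first-order differential calculus $(\Omega^1_H,\mathrm{d})$, and let $X\in\chi^R_H$ be a left invariant right vector field (independent of time). On $M=C^\infty(\mathbb{R},H)$ consider the connection $$\nabla_M m=\mathrm{d}t\otimes\big(\dot m+X(\mathrm{d}m)\big),$$ where $\dot m=\frac{\partial m}{\partial t}$ and $\mathrm{d}m$, $X$ are applied pointwise in $t$, i.e. $X(\mathrm{d}m)(t)=X(\mathrm{d}(m(t)))$. Then the equation $\nabla_M m=0$, i.e. $\dot m=-X(\mathrm{d}m)$, has, for each initial value $m(0)\in H$, the solution $$m(t)=m(0)_{(1)}\,\exp\big(-t\,(X\circ\omega)\big)\big(m(0)_{(2)}\big),$$ where $\exp(-t(X\circ\omega))=\sum_{n\ge 0}\frac{(-t)^n}{n!}(X\circ\omega)^n$ is taken as a power series in elements of the dual $H'$.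
   Context: Sweedler notation $\Delta h=h_{(1)}\otimes h_{(2)}$ is used. A first-order differential calculus on $H$ is an $H$-bimodule $\Omega^1_H$ with a derivation $\mathrm{d}:H\to\Omega^1_H$ such that $\Omega^1_H$ is spanned by the elements $c\,\mathrm{d}b$. It is left covariant if there is a left $H$-coaction $\Delta_L:\Omega^1_H\to H\otimes\Omega^1_H$, written $\Delta_L\xi=\xi_{[-1]}\otimes\xi_{[0]}$, with $\Delta_L(h\,\mathrm{d}k)=h_{(1)}k_{(1)}\otimes h_{(2)}\mathrm{d}k_{(2)}$. The space of left invariant 1-forms is $\Lambda^1_H=\{\xi:\Delta_L\xi=1\otimes\xi\}$. The right vector fields $\chi^R_H$ are the right $H$-module maps $X:\Omega^1_H\to H$. $X$ is left invariant if it is a left comodule map, i.e. $X(\eta)_{(1)}\otimes X(\eta)_{(2)}=\eta_{[-1]}\otimes X(\eta_{[0]})$ for all $\eta\in\Omega^1_H$; then $X(\xi)\in\mathbb{C}1$ for $\xi\in\Lambda^1_H$, and $\mathbb{C}1$ is identified with $\mathbb{C}$. The map $\omega:H\to\Lambda^1_H$ is $\omega(h)=\mathrm{d}h_{(2)}\,S^{-1}(h_{(1)})$. Thus $X\circ\omega:H\to\mathbb{C}$ is a linear functional on $H$. Functionals on $H$ are multiplied by the convolution product $(\alpha\beta)(h)=\alpha(h_{(1)})\beta(h_{(2)})$, with identity the counit $\epsilon$, so $(X\circ\omega)^0=\epsilon$. The exponential is evaluated on elements of $H$ pointwise. $C^\infty(\mathbb{R},H)$ denotes infinitely differentiable functions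 from $\mathbb{R}$ to $H$ (for infinite-dimensional $H$, the curves in the statement take values in a finite-dimensional subspace, so differentiation in $t$ can be understood there). *)

(* Defs.v *)
From HB Require Import structures.
From mathcomp Require Import all_boot all_order all_algebra.
From mathcomp Require Import all_classical all_reals all_analysis.
From mathcomp Require Import complex generic_quotient ring.

Set Implicit Arguments.
Unset Strict Implicit.
Unset Printing Implicit Defensive.
Import Order.TTheory GRing.Theory Num.Theory.
Import numFieldNormedType.Exports.
Local Open Scope classical_set_scope.
Local Open Scope quotient_scope.
Local Open Scope ring_scope.

(** [tensor U V] is the free commutative monoid on [U * V] (lists of pairs, read
  as formal sums of elementary tensors) modulo the congruence generated by
  bilinearity. *)

Section TensorRelation.
Variables (K : comPzRingType) (U V : lmodType K).

Inductive teq : seq (U * V) -> seq (U * V) -> Prop :=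
| teq_refl s : teq s s
| teq_sym s t : teq s t -> teq t s
| teq_trans s t r : teq s t -> teq t r -> teq s r
| teq_cat s s' t t' : teq s s' -> teq t t' -> teq (s ++ t) (s' ++ t')
| teq_comm s t : teq (s ++ t) (t ++ s)
| teq_0l v : teq [:: (0, v)] [::]
| teq_Dl u u' v : teq [:: (u + u', v)] [:: (u, v); (u', v)]
| teq_Dr u v v' : teq [:: (u, v + v')] [:: (u, v); (u, v')]
| teq_Z (a : K) u v : teq [:: (a *: u, v)] [:: (u, a *: v)].

Definition teqb : rel (seq (U * V)) := fun s t => `[< teq s t >].

Lemma teqb_equiv : equiv_class_of teqb.
Proof.
split=> [s|s t|t s r]; first exact/asboolP/teq_refl.
  by apply/asboolP/asboolP; apply: teq_sym.
by move=> /asboolP st /asboolP tr; apply/asboolP; apply: teq_trans tr.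
Qed.

Canonical teqb_equiv_rel := EquivRelPack teqb_equiv.

Definition tensor := {eq_quot teqb_equiv_rel}.

HB.instance Definition _ := Choice.on tensor.
HB.instance Definition _ := Quotient.on tensor.

Definition tens (u : U) (v : V) : tensor := \pi_tensor [:: (u, v)].

End TensorRelation.

Notation "u *t v" := (tens u v) (at level 40, left associativity).

Section TensorModule.
Variables (K : comPzRingType) (U V : lmodType K).
Local Notation T := (tensor U V).
Implicit Types (s t : seq (U * V)) (x y z : T).

Lemma tensor_eqP s t : \pi_T s = \pi_T t <-> teq s t.
Proof.
split=> [/eqquotP /asboolP //|st].
by apply/eqquotP/asboolP.
Qed.

Lemma tensW (P : T -> Prop) : (forall s, P (\pi_T s)) -> forall x, P x.
Proof. by move=> Ppi x; rewrite -[x]reprK. Qed.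

Lemma repr_teq s : teq (repr (\pi_T s)) s.
Proof. by apply/tensor_eqP; rewrite reprK. Qed.

Definition tmap1 (f : U -> U) s : seq (U * V) := [seq (f p.1, p.2) | p <- s].

Lemma teq_tmap1 (f : {linear U -> U}) s t :
  teq s t -> teq (tmap1 f s) (tmap1 f t).
Proof.
elim=> {s t}; rewrite /tmap1 /=.
- by move=> s; apply: teq_refl.
- by move=> s t _; apply: teq_sym.
- by move=> s t r _ + _; apply: teq_trans.
- by move=> s s' t t' _ + _; rewrite !map_cat; apply: teq_cat.
- by move=> s t; rewrite !map_cat; apply: teq_comm.
- by move=> v; rewrite linear0; apply: teq_0l.
- by move=> u u' v; rewrite linearD; apply: teq_Dl.
- by move=> u v v'; apply: teq_Dr.
- by move=> a u v; rewrite linearZ; apply: teq_Z.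
Qed.

Definition tadd x y : T := \pi_T (repr x ++ repr y).
Definition tzero : T := \pi_T [::].
Definition topp x : T := \pi_T (tmap1 -%R (repr x)).
Definition tscale (a : K) x : T := \pi_T (tmap1 ( *:%R a) (repr x)).

Lemma tadd_pi s t : tadd (\pi_T s) (\pi_T t) = \pi_T (s ++ t).
Proof. by apply/tensor_eqP/teq_cat; apply: repr_teq. Qed.

Lemma topp_pi s : topp (\pi_T s) = \pi_T (tmap1 -%R s).
Proof. by apply/tensor_eqP/(@teq_tmap1 -%R); apply: repr_teq. Qed.

Lemma tscale_pi a s : tscale a (\pi_T s) = \pi_T (tmap1 ( *:%R a) s).
Proof. by apply/tensor_eqP/(@teq_tmap1 ( *:%R a)); apply: repr_teq. Qed.

Lemma taddA : associative tadd.
Proof.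
move=> x y z; elim/tensW: x => s; elim/tensW: y => t; elim/tensW: z => r.
by rewrite !tadd_pi catA.
Qed.

Lemma taddC : commutative tadd.
Proof.
move=> x y; elim/tensW: x => s; elim/tensW: y => t.
by rewrite !tadd_pi; apply/tensor_eqP/teq_comm.
Qed.

Lemma tadd0 : left_id tzero tadd.
Proof. by move=> x; elim/tensW: x => s; rewrite tadd_pi. Qed.

Lemma tadd_pair u u' v :
  tadd (u *t v) (u' *t v) = (u + u') *t v :> T.
Proof. by rewrite tadd_pi; apply/tensor_eqP/teq_sym/teq_Dl. Qed.

Lemma tadd_cons p s : \pi_T (p :: s) = tadd (p.1 *t p.2) (\pi_T s).
Proof. by rewrite tadd_pi; case: p. Qed.

Lemma tens0l v : 0 *t v = tzero :> T.
Proof. exact/tensor_eqP/teq_0l. Qed.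

Lemma taddN : left_inverse tzero topp tadd.
Proof.
move=> x; elim/tensW: x; elim=> [|[u v] s IH].
  by rewrite topp_pi tadd_pi.
rewrite topp_pi /= !tadd_cons /= -topp_pi.
have AC (a b c d : T) : tadd (tadd a b) (tadd c d) = tadd (tadd a c) (tadd b d).
  by rewrite -!taddA; congr tadd; rewrite !taddA [tadd b c]taddC.
by rewrite AC IH tadd_pair addNr tens0l tadd0.
Qed.

HB.instance Definition _ := GRing.isZmodule.Build T taddA taddC tadd0 taddN.

Lemma tscaleA a b x : tscale a (tscale b x) = tscale (a * b) x.
Proof.
elim/tensW: x => s; rewrite !tscale_pi /tmap1 -map_comp; congr (\pi_T _).
by apply: eq_map => p /=; rewrite scalerA.
Qed.

Lemma tscale1 : left_id 1 tscale.
Proof.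
move=> x; elim/tensW: x => s; rewrite tscale_pi /tmap1.
rewrite -[in RHS](map_id s); congr (\pi_T _).
by apply: eq_map => -[u v] /=; rewrite scale1r.
Qed.

Lemma tscaleDr : right_distributive tscale +%R.
Proof.
move=> a x y; elim/tensW: x => s; elim/tensW: y => t.
by rewrite /GRing.add /= tadd_pi !tscale_pi tadd_pi /tmap1 map_cat.
Qed.

Lemma tscaleDl x : {morph tscale^~ x : a b / a + b}.
Proof.
move=> a b; rewrite [RHS]/GRing.add /=; elim/tensW: x.
elim=> [|[u v] s IH]; first by rewrite !tscale_pi tadd_pi.
rewrite !tscale_pi /= !tadd_cons /= -!tscale_pi IH scalerDl -tadd_pair.
by rewrite -!taddA; congr tadd; rewrite !taddA; congr tadd; apply: taddC.
Qed.

HB.instance Definition _ :=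
  GRing.Zmodule_isLmodule.Build K T tscaleA tscale1 tscaleDr tscaleDl.

Lemma tensDl u u' v : (u + u') *t v = u *t v + u' *t v :> T.
Proof. by rewrite -tadd_pair. Qed.

Lemma tensZl a u v : (a *: u) *t v = a *: (u *t v) :> T.
Proof. by rewrite /GRing.scale /= tscale_pi. Qed.

Lemma tensDr u v v' : u *t (v + v') = u *t v + u *t v' :> T.
Proof. by rewrite [RHS]/GRing.add /= tadd_pi; apply/tensor_eqP/teq_Dr. Qed.

Lemma tensZr a u v : u *t (a *: v) = a *: (u *t v) :> T.
Proof. by rewrite -tensZl; apply/esym/tensor_eqP/teq_Z. Qed.

Lemma tensor_sum x : x = \sum_(p <- repr x) p.1 *t p.2.
Proof.
rewrite -[LHS]reprK; elim: (repr x) => [|p s IH]; first by rewrite big_nil.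
by rewrite big_cons -IH tadd_cons.
Qed.

End TensorModule.

(** [tsum f x] is the Sweedler sum: [f x_(1) x_(2)], summed over a
  representative of [x].  The representative is chosen, so that [tsum] is total
  in [f]; the value does not depend on it when [f] is bilinear
  ([tsum_tens], [tsumD], [tsumZ]). *)

Section SweedlerSum.
Variables (K : comPzRingType) (U V W : lmodType K).

Definition bilinear_map (f : U -> V -> W) : Prop :=
  (forall v, linear (f^~ v)) /\ (forall u, linear (f u)).

Definition tsum (f : U -> V -> W) (x : tensor U V) : W :=
  \sum_(p <- repr x) f p.1 p.2.

Variable f : U -> V -> W.
Hypothesis fP : bilinear_map f.

Let fDl u u' v : f (u + u') v = f u v + f u' v.
Proof. by have := fP.1 v 1 u u'; rewrite !scale1r. Qed.
Let fDr u v v' : f u (v + v') = f u v + f u v'.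
Proof. by have := fP.2 u 1 v v'; rewrite !scale1r. Qed.
Let f0l v : f 0 v = 0.
Proof. by apply: (addIr (f 0 v)); rewrite -fDl !add0r. Qed.
Let f0r u : f u 0 = 0.
Proof. by apply: (addIr (f u 0)); rewrite -fDr !add0r. Qed.
Let fZl a u v : f (a *: u) v = a *: f u v.
Proof. by have := fP.1 v a u 0; rewrite /= !addr0 f0l addr0. Qed.
Let fZr a u v : f u (a *: v) = a *: f u v.
Proof. by have := fP.2 u a v 0; rewrite /= !addr0 f0r addr0. Qed.

Lemma teq_sum s t : teq s t ->
  \sum_(p <- s) f p.1 p.2 = \sum_(p <- t) f p.1 p.2.
Proof.
elim=> {s t} //=.
- by move=> s t r _ -> _ ->.
- by move=> s s' t t' _ e _ e'; rewrite !big_cat /= e e'.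
- by move=> s t; rewrite !big_cat /= addrC.
- by move=> v; rewrite big_cons !big_nil f0l addr0.
- by move=> u u' v; rewrite !big_cons !big_nil !addr0 fDl.
- by move=> u v v'; rewrite !big_cons !big_nil !addr0 fDr.
- by move=> a u v; rewrite !big_cons !big_nil /= fZl fZr.
Qed.

Lemma tsum_pi s : tsum f (\pi_(tensor U V) s) = \sum_(p <- s) f p.1 p.2.
Proof. exact/teq_sum/repr_teq. Qed.

Lemma tsum_tens u v : tsum f (u *t v) = f u v.
Proof. by rewrite /tens tsum_pi big_cons big_nil addr0. Qed.

Lemma tsumD x y : tsum f (x + y) = tsum f x + tsum f y.
Proof. by rewrite /GRing.add /= /tadd tsum_pi big_cat. Qed.

Lemma tsumZ a x : tsum f (a *: x) = a *: tsum f x.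
Proof.
rewrite {1}/GRing.scale /= /tscale tsum_pi /tmap1 big_map scaler_sumr.
by apply: eq_bigr => p _; rewrite fZl.
Qed.

End SweedlerSum.

Record hopfAlgebra (K : fieldType) (H : algType K) := HopfAlgebra {
  Delta : {linear H -> tensor H H};
  counit : {linear H -> K^o};
  antipode : {linear H -> H};
  Delta_coassoc : forall h,
    tsum (fun a b => tsum (fun a1 a2 => a1 *t (a2 *t b)) (Delta a)) (Delta h)
    = tsum (fun a b => a *t Delta b) (Delta h);
  Delta_counitl : forall h, tsum (fun a b => counit a *: b) (Delta h) = h;
  Delta_counitr : forall h, tsum (fun a b => counit b *: a) (Delta h) = h;
  Delta1 : Delta 1 = 1 *t 1;
  DeltaM : forall h k, Delta (h * k) =
    tsum (fun h1 h2 => tsum (fun k1 k2 => (h1 * k1) *t (h2 * k2)) (Delta k))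
         (Delta h);
  counit1 : counit 1 = 1;
  counitM : forall h k, counit (h * k) = counit h * counit k;
  antipodel : forall h,
    tsum (fun a b => antipode a * b) (Delta h) = counit h *: 1;
  antipoder : forall h,
    tsum (fun a b => a * antipode b) (Delta h) = counit h *: 1
}.

Record fodc (K : fieldType) (H : algType K) (Omega : lmodType K) := Fodc {
  lact : H -> Omega -> Omega;
  ract : Omega -> H -> Omega;
  lact_bilinear : bilinear_map lact;
  lact1 : forall xi, lact 1 xi = xi;
  lactM : forall h k xi, lact (h * k) xi = lact h (lact k xi);
  ract_bilinear : bilinear_map ract;
  ract1 : forall xi, ract xi 1 = xi;
  ractM : forall xi h k, ract xi (h * k) = ract (ract xi h) k;
  lract : forall h xi k, ract (lact h xi) k = lact h (ract xi k);
  dd : {linear H -> Omega};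
  dd_leibniz : forall h k, dd (h * k) = ract (dd h) k + lact h (dd k);
  dd_span : forall xi,
    exists s : seq (H * H), xi = \sum_(p <- s) lact p.1 (dd p.2)
}.

Record leftCovariant (K : fieldType) (H : algType K) (Hh : hopfAlgebra H)
    (Omega : lmodType K) (calc : fodc H Omega) := LeftCovariant {
  coact : {linear Omega -> tensor H Omega};
  coact_coassoc : forall xi,
    tsum (fun a x => tsum (fun a1 a2 => a1 *t (a2 *t x)) (Delta Hh a))
         (coact xi)
    = tsum (fun a x => a *t coact x) (coact xi);
  coact_counit : forall xi,
    tsum (fun a x => counit Hh a *: x) (coact xi) = xi;
  coact_dd : forall h k, coact (lact calc h (dd calc k)) =
    tsum (fun h1 h2 =>
      tsum (fun k1 k2 => (h1 * k1) *t lact calc h2 (dd calc k2)) (Delta Hh k))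
      (Delta Hh h)
}.

Record rightVectorField (K : fieldType) (H : algType K) (Omega : lmodType K)
    (calc : fodc H Omega) := RightVectorField {
  rvf_fun :> {linear Omega -> H};
  rvf_ract : forall xi h, rvf_fun (ract calc xi h) = rvf_fun xi * h
}.

Section Calculus.
Variables (K : fieldType) (H : algType K) (Hh : hopfAlgebra H).
Variables (Omega : lmodType K) (calc : fodc H Omega).

Definition left_invariant (cov : leftCovariant Hh calc)
    (X : rightVectorField calc) : Prop :=
  forall eta, Delta Hh (X eta) = tsum (fun a x => a *t X x) (coact cov eta).

Definition left_invariant_form (cov : leftCovariant Hh calc) (xi : Omega) :
    Prop :=
  coact cov xi = 1 *t xi.

Lemma left_invariant_scalar cov (X : rightVectorField calc) xi :
  left_invariant cov X -> left_invariant_form cov xi ->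
  X xi = (counit Hh (X xi))%:A.
Proof.
move=> Xinv xiinv; rewrite -[LHS](Delta_counitr Hh) Xinv xiinv.
rewrite tsum_tens; last first.
  split=> [x c a a'|a c x x'] /=; first by rewrite tensDl tensZl.
  by rewrite linearP tensDr tensZr.
rewrite tsum_tens //; split=> [b c a a'|a c b b'] /=.
  by rewrite scalerDr !scalerA mulrC.
by rewrite linearP scalerDl -scalerA.
Qed.

(** [Sinv] stands for the inverse of the antipode. *)
Definition omega (Sinv : H -> H) (h : H) : Omega :=
  tsum (fun a b => ract calc (dd calc b) (Sinv a)) (Delta Hh h).

(** The identification of the line [K 1] in [H] with [K]; 0 off this line. *)
Definition scalar_of (x : H) : K := xget 0 [set c : K | x = c%:A].

Lemma scalar_ofA c : scalar_of c%:A = c.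
Proof.
rewrite /scalar_of; case: xgetP => [y _ /= cy|/(_ c)/(_ erefl)//].
by apply/esym/(fmorph_inj (GRing.in_alg H)).
Qed.

Definition X_omega (Sinv : H -> H) (X : rightVectorField calc) (h : H) : K :=
  scalar_of (X (omega Sinv h)).

Definition conv (alpha beta : H -> K) (h : H) : K :=
  tsum (W := K^o) (fun a b => alpha a * beta b) (Delta Hh h).

Definition convpow (alpha : H -> K) (n : nat) : H -> K :=
  iter n (conv alpha) (counit Hh).

End Calculus.

Section Exponential.
Variables (R : realType) (H : algType R[i]) (Hh : hopfAlgebra H).

(** [conv_exp_series z alpha h] is the sequence of partial sums of
  [exp (z alpha)] at [h], and [conv_exp] its limit in the complex numbers. *)
Definition conv_exp_series (z : R[i]) (alpha : H -> R[i]) (h : H) :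
    nat -> (R[i])^o :=
  series (fun n => z ^+ n / n`!%:R * convpow Hh alpha n h : (R[i])^o).

Definition conv_exp (z : R[i]) (alpha : H -> R[i]) (h : H) : R[i] :=
  limn (conv_exp_series z alpha h).

End Exponential.

Section SmoothReal.
Variable R : realType.
Implicit Types f g : R -> R.

Definition rsmooth f : Prop := forall n t, derivable (derive1n n f) t 1.

Let Dn := fix Dn n f : Prop := if n is n'.+1 then
  (forall t, derivable f t 1) /\ Dn n' (derive1 f) else True.

Lemma rsmoothP f : rsmooth f <-> forall n, Dn n f.
Proof.
split=> [+ n|Df n].
  elim: n f => [//|n IH] f sf /=; split; first exact: (sf 0%N).
  by apply: IH => k t; have := sf k.+1 t; rewrite /derive1n iterSr.
elim: n f Df => [|n IH] f Df t; first exact: (Df 1%N).1.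
by rewrite /derive1n iterSr; apply: IH => k; exact: (Df k.+1).2.
Qed.

Lemma DnW n f : Dn n.+1 f -> Dn n f.
Proof.
by elim: n f => [//|n IH] f [df Df]; split => //; apply: IH.
Qed.

Lemma DnD n f g : Dn n f -> Dn n g -> Dn n (fun t => f t + g t).
Proof.
elim: n f g => [//|n IH] f g [df Df] [dg Dg]; split.
  by move=> t; apply: derivableD.
have -> : derive1 (fun t => f t + g t) =
    (fun t => derive1 f t + derive1 g t).
  by apply/funext => t; rewrite !derive1E deriveD.
exact: IH.
Qed.

Lemma DnM n f g : Dn n f -> Dn n g -> Dn n (fun t => f t * g t).
Proof.
elim: n f g => [//|n IH] f g Df Dg; split.
  by move=> t; apply: derivableM; [exact: Df.1|exact: Dg.1].
have -> : derive1 (fun t => f t * g t) =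
    (fun t => f t * derive1 g t + g t * derive1 f t).
  by apply/funext => t; rewrite !derive1E deriveM //; [exact: Df.1|exact: Dg.1].
by apply: DnD; apply: IH; [exact: DnW|exact: Dg.2|exact: DnW|exact: Df.2].
Qed.

Lemma Dn_cst n (a : R) : Dn n (cst a).
Proof.
elim: n a => [//|n IH] a; split=> [t|]; first exact: derivable_cst.
have -> : derive1 (cst a) = cst 0.
  by apply/funext => t; rewrite derive1_cst.
exact: IH.
Qed.

Lemma rsmoothD f g : rsmooth f -> rsmooth g -> rsmooth (fun t => f t + g t).
Proof.
by rewrite !rsmoothP => Df Dg n; apply: DnD.
Qed.

Lemma rsmoothM f g : rsmooth f -> rsmooth g -> rsmooth (fun t => f t * g t).
Proof.
by rewrite !rsmoothP => Df Dg n; apply: DnM.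
Qed.

Lemma rsmooth_cst a : rsmooth (cst a).
Proof. by rewrite rsmoothP => n; apply: Dn_cst. Qed.

Lemma rsmoothN f : rsmooth f -> rsmooth (fun t => - f t).
Proof.
move=> sf; rewrite [X in rsmooth X](_ : _ = fun t => cst (-1) t * f t).
  by apply: rsmoothM => //; apply: rsmooth_cst.
by apply/funext => t; rewrite mulN1r.
Qed.

Lemma rsmooth_derive1 f : rsmooth f -> rsmooth (derive1 f).
Proof. by move=> sf n t; have := sf n.+1 t; rewrite /derive1n iterSr. Qed.

End SmoothReal.

Section SmoothComplex.
Variable R : realType.

Definition csmooth_pred : {pred R -> R[i]} := fun f =>
  `[< rsmooth (fun t => complex.Re (f t)) /\ rsmooth (fun t => complex.Im (f t)) >].

Lemma csmooth_subring : subring_closed csmooth_pred.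
Proof.
split.
- by apply/asboolP; split; apply: rsmooth_cst.
- move=> f g /asboolP[f1 f2] /asboolP[g1 g2]; apply/asboolP; split.
    rewrite [X in rsmooth X](_ : _ = fun t => complex.Re (f t) + - complex.Re (g t)).
      exact: rsmoothD f1 (rsmoothN g1).
    by apply/funext => t /=; rewrite !fctE; case: (f t) (g t) => [? ?] [? ?].
  rewrite [X in rsmooth X](_ : _ = fun t => complex.Im (f t) + - complex.Im (g t)).
    exact: rsmoothD f2 (rsmoothN g2).
  by apply/funext => t /=; rewrite !fctE; case: (f t) (g t) => [? ?] [? ?].
- move=> f g /asboolP[f1 f2] /asboolP[g1 g2]; apply/asboolP; split.
    rewrite [X in rsmooth X](_ : _ =
        fun t => complex.Re (f t) * complex.Re (g t) + - (complex.Im (f t) * complex.Im (g t))).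
      exact: rsmoothD (rsmoothM f1 g1) (rsmoothN (rsmoothM f2 g2)).
    by apply/funext => t /=; rewrite !fctE; case: (f t) (g t) => [? ?] [? ?].
  rewrite [X in rsmooth X](_ : _ =
        fun t => complex.Re (f t) * complex.Im (g t) + complex.Im (f t) * complex.Re (g t)).
    exact: rsmoothD (rsmoothM f1 g2) (rsmoothM f2 g1).
  by apply/funext => t /=; rewrite !fctE; case: (f t) (g t) => [? ?] [? ?].
Qed.

HB.instance Definition _ :=
  GRing.isSubringClosed.Build (R -> R[i]) csmooth_pred csmooth_subring.

Record csmooth := CSmooth {
  csmooth_fun :> R -> R[i];
  _ : csmooth_fun \in csmooth_pred
}.

HB.instance Definition _ := [isSub for csmooth_fun].
HB.instance Definition _ := [Choice of csmooth by <:].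
HB.instance Definition _ :=
  GRing.SubChoice_isSubComPzRing.Build _ _ csmooth (subringClosedP _).


Lemma csmoothP (a : csmooth) :
  rsmooth (fun t => complex.Re (a t)) /\ rsmooth (fun t => complex.Im (a t)).
Proof. by case: a => a /= /asboolP. Qed.

Definition deriv_fun (a : csmooth) (t : R) : R[i] :=
  Complex (derive1 (fun t => complex.Re (a t)) t)
          (derive1 (fun t => complex.Im (a t)) t).

Lemma deriv_fun_smooth a : deriv_fun a \in csmooth_pred.
Proof.
by have [a1 a2] := csmoothP a; apply/asboolP; split;
  [exact: rsmooth_derive1 a1|exact: rsmooth_derive1 a2].
Qed.

Definition deriv (a : csmooth) : csmooth := CSmooth (deriv_fun_smooth a).

Lemma csmoothD (a b : csmooth) t : (a + b) t = a t + b t.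
Proof. by []. Qed.

Lemma csmoothM (a b : csmooth) t : (a * b) t = a t * b t.
Proof. by []. Qed.

Lemma csmooth_cst_subproof (z : R[i]) : cst z \in csmooth_pred.
Proof. by apply/asboolP; split; apply: rsmooth_cst. Qed.

Definition csmooth_cst z : csmooth := CSmooth (csmooth_cst_subproof z).

Lemma csmooth_eq (a b : csmooth) : (forall t, a t = b t) -> a = b.
Proof. by move=> ab; apply/val_inj/funext. Qed.

Lemma derivD a b : deriv (a + b) = deriv a + deriv b.
Proof.
apply: csmooth_eq => t; rewrite csmoothD /= /deriv_fun.
have [a1 a2] := csmoothP a; have [b1 b2] := csmoothP b.
have -> : (fun t => complex.Re ((a + b) t)) =
          (fun t => complex.Re (a t)) + (fun t => complex.Re (b t)).
  by apply/funext => u; rewrite csmoothD fctE; case: (a u) (b u) => ? ? [].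
have -> : (fun t => complex.Im ((a + b) t)) =
          (fun t => complex.Im (a t)) + (fun t => complex.Im (b t)).
  by apply/funext => u; rewrite csmoothD fctE; case: (a u) (b u) => ? ? [].
by rewrite !derive1E !deriveD//; [exact: (a2 0%N)|exact: (b2 0%N)
  |exact: (a1 0%N)|exact: (b1 0%N)].
Qed.

Lemma derivM a b : deriv (a * b) = deriv a * b + a * deriv b.
Proof.
apply: csmooth_eq => t; rewrite csmoothD !csmoothM /= /deriv_fun.
have [/(_ 0%N) a1 /(_ 0%N) a2] := csmoothP a.
have [/(_ 0%N) b1 /(_ 0%N) b2] := csmoothP b.
have -> : (fun t => complex.Re ((a * b) t)) =
          (fun t => complex.Re (a t)) * (fun t => complex.Re (b t))
          - (fun t => complex.Im (a t)) * (fun t => complex.Im (b t)).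
  by apply/funext => u; rewrite csmoothM !fctE; case: (a u) (b u) => ? ? [].
have -> : (fun t => complex.Im ((a * b) t)) =
          (fun t => complex.Re (a t)) * (fun t => complex.Im (b t))
          + (fun t => complex.Im (a t)) * (fun t => complex.Re (b t)).
  by apply/funext => u; rewrite csmoothM !fctE; case: (a u) (b u) => ? ? [].
rewrite !derive1E deriveB; [|exact: derivableM..].
rewrite deriveD; [|exact: derivableM..].
rewrite !deriveM //.
set x1 := derive _ _ _; set x2 := derive _ _ _; set y1 := derive _ _ _.
set y2 := derive _ _ _.
case: (a t) (b t) => p q [p' q'] /=.
by apply/eqP; rewrite eq_complex /=; apply/andP; split; apply/eqP;
  rewrite /GRing.scale /=; ring.
Qed.

Lemma deriv_cst z : deriv (csmooth_cst z) = 0.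
Proof.
by apply: csmooth_eq => t; rewrite /= /deriv_fun /= !derive1_cst.
Qed.

End SmoothComplex.

(** A curve in [H] is smooth when it is a finite sum of fixed vectors with smooth
  coefficients, that is, when it is a smooth curve in a finite-dimensional
  subspace of [H]; it is differentiated there. *)

Section Curves.
Variables (R : realType) (H : lmodType R[i]).
Implicit Types (s : seq (csmooth R * H)) (t : R).

Definition scurve s t : H := \sum_(p <- s) p.1 t *: p.2.

Definition curve_pred : {pred R -> H} :=
  fun f => `[< exists s, forall t, f t = scurve s t >].

Lemma curve_zmod : zmod_closed curve_pred.
Proof.
split; first by apply/asboolP; exists [::] => t; rewrite /scurve big_nil.
move=> f g /asboolP[s sf] /asboolP[r rg]; apply/asboolP.
exists (s ++ [seq (p.1, - p.2) | p <- r]) => t.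
rewrite /scurve big_cat big_map /= !fctE sf rg; congr (_ + _).
by rewrite -sumrN; apply: eq_bigr => p _; rewrite scalerN.
Qed.

HB.instance Definition _ :=
  GRing.isZmodClosed.Build (R -> H) curve_pred curve_zmod.

Record curve := Curve {
  curve_fun :> R -> H;
  _ : curve_fun \in curve_pred
}.

HB.instance Definition _ := [isSub for curve_fun].
HB.instance Definition _ := [Choice of curve by <:].
HB.instance Definition _ := [SubChoice_isSubZmodule of curve by <:].

Implicit Types (m : curve) (a b : csmooth R).

Lemma curveP m : exists s, forall t, m t = scurve s t.
Proof. by case: m => f /= /asboolP. Qed.

Lemma curve_eq m m' : (forall t, m t = m' t) -> m = m'.
Proof. by move=> mm'; apply/val_inj/funext. Qed.

Lemma curveD m m' t : (m + m') t = m t + m' t.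
Proof. by []. Qed.

Lemma scurve_subproof s : scurve s \in curve_pred.
Proof. by apply/asboolP; exists s. Qed.

Lemma cscale_subproof a m : (fun t => a t *: m t) \in curve_pred.
Proof.
have [s sm] := curveP m; apply/asboolP; exists [seq (a * p.1, p.2) | p <- s].
move=> t; rewrite sm /scurve big_map scaler_sumr; apply: eq_bigr => p _.
by rewrite scalerA.
Qed.

Definition cscale a m : curve := Curve (cscale_subproof a m).

Lemma cscaleA a b m : cscale a (cscale b m) = cscale (a * b) m.
Proof. by apply: curve_eq => t; rewrite [LHS]scalerA. Qed.

Lemma cscale1 : left_id 1 cscale.
Proof. by move=> m; apply: curve_eq => t /=; rewrite scale1r. Qed.

Lemma cscaleDr : right_distributive cscale +%R.
Proof.
by move=> a m m'; apply: curve_eq => t; apply: scalerDr.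
Qed.

Lemma cscaleDl m : {morph cscale^~ m : a b / a + b}.
Proof.
by move=> a b; apply: curve_eq => t; apply: scalerDl.
Qed.

HB.instance Definition _ := GRing.Zmodule_isLmodule.Build (csmooth R) curve
  cscaleA cscale1 cscaleDr cscaleDl.

Definition dscurve s : seq (csmooth R * H) := [seq (deriv p.1, p.2) | p <- s].

(** The presentation of [m] is chosen, and [dotE] shows that the derivative does
  not depend on it. *)
Definition dot m : curve :=
  Curve (scurve_subproof (dscurve (projT1 (cid (curveP m))))).

Lemma scurve_add_span s a (z : seq R[i]) t :
  scurve [seq (q.1.1 + a * csmooth_cst q.2, q.1.2) | q <- zip s z] t =
  \sum_(q <- zip s z) q.1.1 t *: q.1.2
  + a t *: \sum_(q <- zip s z) q.2 *: q.1.2.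
Proof.
rewrite /scurve big_map scaler_sumr -big_split; apply: eq_bigr => q _.
transitivity ((q.1.1 t + a t * q.2) *: q.1.2) => //.
by rewrite scalerDl scalerA.
Qed.

Lemma dscurve0 s :
  (forall t, scurve s t = 0) -> forall t, scurve (dscurve s) t = 0.
Proof.
have [n] := ubnP (size s); elim: n s => // n IH [|[a v] s] /= sn s0 t.
  by rewrite /scurve big_nil.
have sE t' : a t' *: v + scurve s t' = 0 by rewrite -(s0 t') /scurve big_cons.
have [[z [zs vE]]|vN] := pselect (exists z : seq R[i],
  size z = size s /\ v = \sum_(q <- zip s z) q.2 *: q.1.2).
- have szE (F : csmooth R -> csmooth R) t' :
      \sum_(q <- zip s z) F q.1.1 t' *: q.1.2 =
      \sum_(p <- s) F p.1 t' *: p.2.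
    rewrite -[in RHS](@unzip1_zip _ _ s z) ?zs // /unzip1 big_map.
    by [].
  have := IH [seq (q.1.1 + a * csmooth_cst q.2, q.1.2) | q <- zip s z].
  rewrite size_map size1_zip ?zs // => /(_ sn).
  have h0 t' :
      scurve [seq (q.1.1 + a * csmooth_cst q.2, q.1.2) | q <- zip s z] t' = 0.
    by rewrite scurve_add_span -vE (szE id) addrC; apply: sE.
  move=> /(_ h0 t) {h0}; rewrite /dscurve -map_comp.
  have -> : [seq (deriv p.1, p.2) | p <- s] =
            [seq (deriv q.1.1, q.1.2) | q <- zip s z].
    rewrite -[in LHS](@unzip1_zip _ _ s z) ?zs // /unzip1 -map_comp.
    exact: eq_map.
  rewrite /scurve !big_cons !big_map /= => h0; rewrite -[RHS]h0.
  rewrite [in LHS]vE scaler_sumr -big_split; apply: eq_bigr => q _.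
  transitivity (deriv (q.1.1 + a * csmooth_cst q.2) t *: q.1.2) => //.
  rewrite derivD derivM deriv_cst mulr0 addr0.
  transitivity ((deriv q.1.1 t + deriv a t * q.2) *: q.1.2) => //.
  by rewrite scalerDl scalerA addrC.
- have a0 : a = 0.
    apply: csmooth_eq => t'; apply/eqP; apply: contra_notT vN => at0.
    have {}at0 : a t' != 0 := at0.
    exists [seq - (a t')^-1 * (p.1 : csmooth R) t' | p <- s].
    split; first by rewrite size_map.
    have -> : v = - (a t')^-1 *: scurve s t'.
      apply: (scalerI at0); rewrite scalerA mulrN mulfV // scaleN1r.
      by apply/eqP; rewrite -addr_eq0 sE.
    rewrite -[X in zip X]map_id zip_map big_map scaler_sumr.
    by apply: eq_bigr => p _ /=; rewrite scalerA.
  have d0 : deriv a = 0.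
    have -> : a = csmooth_cst 0 by rewrite a0; apply: csmooth_eq.
    exact: deriv_cst.
  have d0t : deriv a t = 0 by rewrite d0.
  transitivity (deriv a t *: v + scurve (dscurve s) t).
    by rewrite [LHS]big_cons.
  rewrite d0t scale0r add0r; apply: IH => // t'.
  have a0t : a t' = 0 by rewrite a0.
  by have := sE t'; rewrite a0t scale0r add0r.
Qed.

Lemma dotE m s : (forall t, m t = scurve s t) ->
  forall t, dot m t = scurve (dscurve s) t.
Proof.
rewrite /dot; case: cid => r /= rm sm t; apply/eqP; rewrite -subr_eq0; apply/eqP.
pose opp s0 : seq (csmooth R * H) := [seq (p.1, - p.2) | p <- s0].
have oppE s0 t' : scurve (opp s0) t' = - scurve s0 t'.
  by rewrite /scurve big_map -sumrN; apply: eq_bigr => p _; rewrite scalerN.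
have catE s1 s2 t' : scurve (s1 ++ s2) t' = scurve s1 t' + scurve s2 t'.
  by rewrite /scurve big_cat.
have := @dscurve0 (r ++ opp s); rewrite /dscurve map_cat => /(_ _ t).
have -> : [seq (deriv p.1, p.2) | p <- opp s] = opp (dscurve s).
  by rewrite /opp /dscurve -!map_comp.
rewrite catE oppE; apply => t'.
by rewrite catE oppE -rm -sm subrr.
Qed.

Lemma dotD m m' : dot (m + m') = dot m + dot m'.
Proof.
have [s sm] := curveP m; have [r rm] := curveP m'.
apply: curve_eq => t; rewrite curveD (dotE sm) (dotE rm).
rewrite (@dotE _ (s ++ r)) => [|u].
  by rewrite /dscurve map_cat /scurve big_cat.
by rewrite /scurve big_cat curveD sm rm.
Qed.

Lemma dotZ a m : dot (a *: m) = deriv a *: m + a *: dot m.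
Proof.
have [s sm] := curveP m.
apply: curve_eq => t; transitivity (deriv a t *: m t + a t *: dot m t) => //.
rewrite (dotE sm) sm (@dotE _ [seq (a * p.1, p.2) | p <- s]) => [|u].
  rewrite /scurve !big_map !scaler_sumr -big_split; apply: eq_bigr => p _.
  transitivity (deriv (a * p.1) t *: p.2) => //.
  rewrite derivM !scalerA.
  transitivity ((deriv a t * p.1 t + a t * deriv p.1 t) *: p.2) => //.
  by rewrite scalerDl.
transitivity (a u *: m u) => //; rewrite sm /scurve big_map scaler_sumr.
by apply: eq_bigr => p _; rewrite scalerA.
Qed.

Lemma cmap_subproof (L : {linear H -> H}) m : (fun t => L (m t)) \in curve_pred.
Proof.
have [s sm] := curveP m; apply/asboolP; exists [seq (p.1, L p.2) | p <- s].
move=> t; rewrite sm /scurve big_map linear_sum; apply: eq_bigr => p _.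
by rewrite linearZ.
Qed.

Definition cmap (L : {linear H -> H}) m : curve := Curve (cmap_subproof L m).

End Curves.

Section Connection.
Variables (R : realType) (H : algType R[i]) (Omega : lmodType R[i]).
Variables (calc : fodc H Omega) (X : rightVectorField calc).

(** The 1-forms on the real line are the free [csmooth R]-module on [dt]. *)
Definition Omega1R : lmodType (csmooth R) := (csmooth R)^o.
Definition dt : Omega1R := 1 : csmooth R.
Definition dR (a : csmooth R) : Omega1R := deriv a *: dt.

Definition Xd (m : curve H) : curve H := cmap (X \o dd calc) m.

Definition nablaM (m : curve H) : tensor Omega1R (curve H) :=
  dt *t (dot m + Xd m).

Lemma nablaM_connection a m :
  nablaM (a *: m) = dR a *t m + a *: nablaM m.
Proof.
rewrite /nablaM /dR tensZl -tensZr -[in RHS]tensZr -tensDr; congr (_ *t _).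
rewrite dotZ scalerDr addrA; congr (_ + _).
by apply: curve_eq => t /=; rewrite !linearZ.
Qed.

End Connection.

(* Main.v *)
(* Put [chi h = eps (X (d h))].  Left invariance of [X] gives
  [X (d h) = h_(1) chi (h_(2))], and then [X (omega h) = chi h 1] since
  [h_(2) S^-1(h_(1)) = eps(h)].  So the equation is [m' = - A m] where
  [A h = h_(1) chi (h_(2))], and [A^n h = h_(1) chi^n (h_(2))] stays in the span
  of the left tensor factors of [Delta h].  Hence the sequence [chi^n h]
  satisfies a linear recurrence and grows at most geometrically, so that
  [exp (t chi) h] is an entire function of [t], with derivative
  [exp (t chi) (A h)].
  This yields a flow [e^(tA)], and a solution [m] is unique because
  [e^(tA) (m t)] has zero derivative. *)

Require Import Defs.
From HB Require Import structures.
From mathcomp Require Import all_boot all_order all_algebra.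
From mathcomp Require Import all_classical all_reals all_analysis.
From mathcomp Require Import complex.
Import Order.TTheory GRing.Theory Num.Theory.
Import numFieldNormedType.Exports.
Local Open Scope classical_set_scope.
Local Open Scope ring_scope.

Set Implicit Arguments.
Unset Strict Implicit.
Unset Printing Implicit Defensive.

(** * Linearity of Sweedler sums *)

Section SweedlerCalculus.
Variables (K : comPzRingType) (U V W W' : lmodType K).

Lemma eq_tsum (f g : U -> V -> W) x :
  (forall u v, f u v = g u v) -> tsum f x = tsum g x.
Proof. by move=> fg; apply: eq_bigr => p _; apply: fg. Qed.

Lemma linear_tsum (g : W -> W') (f : U -> V -> W) x :
  linear g -> g (tsum f x) = tsum (fun u v => g (f u v)) x.
Proof.
move=> gP; pose gl : {linear W -> W'} :=
  HB.pack g (GRing.isLinear.Build _ _ _ _ g gP).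
exact: (linear_sum gl).
Qed.

Lemma tsum_linear (f : U -> V -> W) : bilinear_map f -> linear (tsum f).
Proof. by move=> fP a x y; rewrite tsumD // tsumZ. Qed.

Lemma tsum_linear_pointwise (f : W' -> U -> V -> W) x :
  (forall u v, linear (fun w => f w u v)) -> linear (fun w => tsum (f w) x).
Proof.
move=> fP a w w'; rewrite /tsum scaler_sumr -big_split.
by apply: eq_bigr => p _; apply: fP.
Qed.

Lemma is_linearZ (g : W -> W') (gP : linear g) a w : g (a *: w) = a *: g w.
Proof.
pose gl : {linear W -> W'} := HB.pack g (GRing.isLinear.Build _ _ _ _ g gP).
exact: (linearZ_LR gl).
Qed.

Lemma is_linearD (g : W -> W') (gP : linear g) w w' : g (w + w') = g w + g w'.
Proof. by have := gP 1 w w'; rewrite !scale1r. Qed.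

Lemma is_linear0 (g : W -> W') (gP : linear g) : g 0 = 0.
Proof. by rewrite -(scale0r 0) (is_linearZ gP) scale0r. Qed.

End SweedlerCalculus.

(** * Coassociativity and the antipode in Sweedler form *)

Section Coalgebra.
Variables (K : fieldType) (H : algType K) (Hh : hopfAlgebra H).
Local Notation Delta := (Delta Hh).
Local Notation counit := (counit Hh).
Local Notation S := (antipode Hh).

Definition trilinear_map (W : lmodType K) (F : H -> H -> H -> W) : Prop :=
  [/\ forall b c, linear (fun a => F a b c), forall a c, linear (F a ^~ c)
    & forall a b, linear (F a b)].

(** The coassociativity axiom lives in [H (x) (H (x) H)]; summing twice with [F] sends both of its
    sides to [W]. Trilinearity makes this independent of the chosen representatives. *)
Lemma tsum_coassoc (W : lmodType K) (F : H -> H -> H -> W) h :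
  trilinear_map F ->
  tsum (fun a b => tsum (fun a1 a2 => F a1 a2 b) (Delta a)) (Delta h) =
  tsum (fun a b => tsum (F a) (Delta b)) (Delta h).
Proof.
move=> [F1 F2 F3].
have FB a : bilinear_map (F a) by split.
pose G a (y : tensor H H) := tsum (F a) y.
have GP : bilinear_map G.
  split=> [y|a]; last exact: tsum_linear.
  by apply: tsum_linear_pointwise => b c; apply: F1.
have /(congr1 (tsum G)) := Delta_coassoc Hh h.
rewrite !(linear_tsum _ _ (tsum_linear GP)) => e.
transitivity (tsum (fun a b => tsum G (tsum (fun a1 a2 => a1 *t (a2 *t b))
    (Delta a))) (Delta h)).
  apply: eq_tsum => a b; rewrite (linear_tsum _ _ (tsum_linear GP)).
  by apply: eq_tsum => a1 a2; rewrite tsum_tens // /G tsum_tens.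
by rewrite e; apply: eq_tsum => a b; rewrite tsum_tens.
Qed.

Lemma counitl_linear (W : lmodType K) (g : H -> W) h : linear g ->
  tsum (fun a b => counit a *: g b) (Delta h) = g h.
Proof.
move=> gP; rewrite -[in RHS](Delta_counitl Hh h) linear_tsum //.
by apply: eq_tsum => a b; rewrite (is_linearZ gP).
Qed.

Lemma counitr_linear (W : lmodType K) (g : H -> W) h : linear g ->
  tsum (fun a b => counit b *: g a) (Delta h) = g h.
Proof.
move=> gP; rewrite -[in RHS](Delta_counitr Hh h) linear_tsum //.
by apply: eq_tsum => a b; rewrite (is_linearZ gP).
Qed.

(** After regrouping, [S(h_(1)) h_(2)] collapses to the counit. Read from right to left, the
    equation inserts such a factor in front of [g]. *)
Lemma antipode_cancel (g : H -> H) h : linear g ->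
  tsum (fun a b => S a * tsum (fun b1 b2 => b1 * g b2) (Delta b)) (Delta h) =
  g h.
Proof.
move=> gP.
transitivity (tsum (fun a b => tsum (fun a1 a2 => S a1 * (a2 * g b)) (Delta a))
    (Delta h)).
  rewrite tsum_coassoc; last first.
    by split=> [b c|a c|a b] k x y; rewrite ?gP ?linearP;
      rewrite ?(mulrDl, mulrDr) -?(scalerAl, scalerAr) ?(mulrDl, mulrDr)
        -?(scalerAl, scalerAr).
  by apply: eq_tsum => a b; rewrite /tsum mulr_sumr.
rewrite -[RHS](counitl_linear _ gP); apply: eq_tsum => a b.
transitivity (tsum (fun a1 a2 => S a1 * a2) (Delta a) * g b).
  by rewrite /tsum mulr_suml; apply: eq_bigr => p _; rewrite mulrA.
by rewrite antipodel -scalerAl mul1r.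
Qed.

(* Both sides are convolution inverse to the multiplication of [H (x) H]. *)
Lemma antipodeM h k : S (h * k) = S k * S h.
Proof.
have SRlin (a b : H) : linear (fun x => a * S (x * b)).
  move=> c x y; rewrite mulrDl -scalerAl linearP.
  by rewrite mulrDr -scalerAr.
have SLlin : linear (fun x => S (h * x)).
  by move=> c x y; rewrite mulrDr -scalerAr linearP.
(* Inserting such factors for [k] and then for [h] gives [S(k_(1)) S(h_(1)) h_(2) k_(2) S(h_(3)
   k_(3))], where the part after [S(h_(1))] is an instance of the antipode axiom for a product. *)
rewrite -[LHS](antipode_cancel k SLlin).
transitivity (tsum (fun b1 b' => counit b' *: (S b1 * S h)) (Delta k));
    last first.
  apply: counitr_linear => c x y; rewrite linearP mulrDl.
  by rewrite -scalerAl.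
apply: eq_tsum => b1 b'; rewrite scalerAr; congr (_ * _).
rewrite -[in RHS](Delta_counitr Hh h).
transitivity (tsum (fun b2 b3 => tsum (fun a1 a' => S a1 *
    tsum (fun a2 a3 => a2 * (b2 * S (a3 * b3))) (Delta a')) (Delta h)) (Delta b')).
  by apply: eq_tsum => b2 b3; rewrite -[LHS](antipode_cancel h (SRlin b2 b3)).
transitivity (tsum (fun a1 a' => S a1 * (counit (a' * b'))%:A) (Delta h));
    last first.
  rewrite linear_tsum; last exact: linearP.
  rewrite linear_tsum; last by move=> c x y; rewrite scalerDr !scalerA mulrC.
  apply: eq_tsum => a1 a'; rewrite linearZ -scalerAr mulr1 scalerA.
  by rewrite counitM mulrC.
rewrite [LHS]exchange_big; apply: eq_bigr => -[a1 a'] _ /=.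
rewrite -mulr_sumr; congr (_ * _).
rewrite -antipoder DeltaM.
have SP : bilinear_map (fun x y => x * S y).
  by split=> [y|x] c a b;
    rewrite ?linearP ?(mulrDl, mulrDr) -?(scalerAl, scalerAr).
rewrite (linear_tsum _ _ (tsum_linear SP)) [LHS]exchange_big.
apply: eq_bigr => -[a2 a3] _ /=; rewrite (linear_tsum _ _ (tsum_linear SP)).
by apply: eq_bigr => -[b2 b3] _ /=; rewrite tsum_tens // mulrA.
Qed.

Lemma antipode1 : S 1 = 1.
Proof.
have := antipoder Hh 1; rewrite Delta1 counit1 scale1r tsum_tens ?mul1r //.
by split=> [y|x] c a b;
    rewrite ?linearP ?(mulrDl, mulrDr) -?(scalerAl, scalerAr).
Qed.

(** [S] is injective and antimultiplicative, so applying it turns the left side into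
    [h_(1) S(h_(2))]. *)
Lemma antipode_inv_mul (Sinv : H -> H) h : cancel S Sinv -> cancel Sinv S ->
  tsum (fun a b => b * Sinv a) (Delta h) = (counit h)%:A.
Proof.
move=> SK SinvK; apply: (can_inj SK).
rewrite linear_tsum; last exact: linearP.
rewrite linearZ /= antipode1 -antipoder.
by apply: eq_tsum => a b; rewrite antipodeM SinvK.
Qed.

(** * The operator dual to convolution by a functional *)

Section Convolution.
Variable alpha : {linear H -> K^o}.

(** The operator [A] for a general functional: the transpose of [beta |-> conv beta alpha] on linear
    functionals. *)
Definition lconv h := tsum (fun a b => alpha b *: a) (Delta h).

Lemma lconv_linear : linear lconv.
Proof.
move=> c x y; rewrite /lconv linearP tsum_linear //.
split=> [v d a b|u d a b] /=; first by rewrite scalerDr !scalerA mulrC.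
by rewrite linearP scalerDl -scalerA.
Qed.

Lemma convpow_linear n : linear (convpow Hh alpha n : H -> K^o).
Proof.
elim: n => [|n IH] c x y; first exact: linearP.
rewrite /convpow !iterS -/(convpow Hh alpha n) /Defs.conv.
rewrite (linearP Delta) tsum_linear //.
split=> [v d a b|u d a b] /=; first by rewrite linearP mulrDl /GRing.scale /= mulrA.
by rewrite IH mulrDr /GRing.scale /= mulrCA.
Qed.

(** The left factors of [Delta h] are the same for all [n]; coassociativity moves each further
    [alpha] onto the right factors. *)
Lemma iter_lconv n h :
  iter n lconv h = tsum (fun a b => convpow Hh alpha n b *: a) (Delta h).
Proof.
elim: n h => [|n IH] h; first by rewrite Delta_counitr.
rewrite iterS IH linear_tsum; last exact: lconv_linear.
transitivity (tsum (fun a b => tsum (fun a1 a2 =>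
    (alpha a2 * convpow Hh alpha n b) *: a1) (Delta a)) (Delta h)).
  apply: eq_tsum => a b; rewrite (is_linearZ lconv_linear) /lconv /tsum scaler_sumr.
  by apply: eq_bigr => p _; rewrite scalerA mulrC.
rewrite tsum_coassoc; last first.
  split=> [b c|a c|a b] d x y; first by rewrite scalerDr !scalerA mulrC.
    by rewrite linearP mulrDl scalerDl scalerA mulrA.
  by rewrite convpow_linear mulrDr scalerDl scalerA mulrCA.
by apply: eq_tsum => a b; rewrite /tsum -scaler_suml.
Qed.

Lemma counit_iter_lconv n h : counit (iter n lconv h) = convpow Hh alpha n h.
Proof.
rewrite iter_lconv linear_tsum; last exact: linearP.
rewrite -[RHS](counitl_linear _ (convpow_linear n)).
by apply: eq_tsum => a b; rewrite linearZ /= [LHS]mulrC.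
Qed.

(** [convpow] multiplies by [alpha] on the left and [lconv] on the right; they agree since both
    sides are the counit of one iterate of [lconv]. *)
Lemma convpowSr n h : convpow Hh alpha n.+1 h = convpow Hh alpha n (lconv h).
Proof. by rewrite -!counit_iter_lconv iterSr. Qed.

End Convolution.

(** * Left invariant vector fields as convolution operators *)

Section VectorField.
Variables (Omega : lmodType K) (calc : fodc H Omega).
Variables (cov : leftCovariant Hh calc) (X : rightVectorField calc).
Hypothesis X_inv : left_invariant cov X.

(** Linear by construction, whereas [X_omega] reads off a scalar by choice; [X_omegaE] identifies
    the two. *)
Definition vf_functional : {linear H -> K^o} := counit \o (X \o dd calc).

Lemma coact_d h :
  coact cov (dd calc h) = tsum (fun a b => a *t dd calc b) (Delta h).
Proof.
rewrite -[dd calc h](lact1 calc) coact_dd Delta1 tsum_tens.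
  by apply: eq_tsum => a b; rewrite mul1r lact1.
have [ll lr] := lact_bilinear calc.
split=> [y|x] c a b; rewrite /tsum scaler_sumr -big_split;
  apply: eq_bigr => p _ /=.
  by rewrite mulrDl -scalerAl tensDl tensZl.
by rewrite ll tensDr tensZr.
Qed.

(** The counit is applied to the second factor of [Delta (X (d h))], which left invariance writes as
    [h_(1) (x) X (d h_(2))]. *)
Lemma vf_lconv h : X (dd calc h) = lconv vf_functional h.
Proof.
rewrite -[LHS](Delta_counitr Hh) X_inv coact_d.
have B : bilinear_map (fun a x => a *t X x : tensor H H).
  by split=> [v c a b|u c a b]; rewrite ?linearP
    ?(tensDl, tensDr) ?(tensZl, tensZr).
have C : bilinear_map (fun a b : H => counit b *: a).
  split=> [v d a b|u d a b] /=; first by rewrite scalerDr !scalerA mulrC.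
  by rewrite linearP scalerDl -scalerA.
rewrite (linear_tsum _ _ (tsum_linear B)) (linear_tsum _ _ (tsum_linear C)).
by apply: eq_tsum => a b; rewrite !tsum_tens.
Qed.

Lemma X_omegaE (Sinv : H -> H) h :
  cancel (antipode Hh) Sinv -> cancel Sinv (antipode Hh) ->
  X_omega Hh Sinv X h = vf_functional h.
Proof.
move=> SK SinvK; have Slin : linear Sinv := can2_linear SK SinvK.
rewrite /X_omega -[RHS](scalar_ofA H); congr (scalar_of _).
rewrite /omega linear_tsum; last exact: linearP.
transitivity (tsum (fun a b => tsum (fun b1 b2 =>
    vf_functional b2 *: (b1 * Sinv a)) (Delta b)) (Delta h)).
  apply: eq_tsum => a b; rewrite rvf_ract vf_lconv /lconv /tsum mulr_suml.
  by apply: eq_bigr => p _; rewrite scalerAl.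
(* Regrouping puts [h_(1)] and [h_(2)] in one coproduct, where [h_(2) S^-1(h_(1))] is a counit. *)
rewrite -(@tsum_coassoc _ (fun a b1 b2 => vf_functional b2 *: (b1 * Sinv a))).
  rewrite -[RHS](counitl_linear (g := fun b => (vf_functional b)%:A)).
    apply: eq_tsum => a b; rewrite scalerA mulrC -scalerA.
    rewrite -(antipode_inv_mul _ SK SinvK).
    by rewrite /tsum scaler_sumr.
  by move=> c x y; rewrite linearP scalerDl -scalerA.
split=> [b c|a c|a b] d x y.
- by rewrite Slin mulrDr scalerDr -scalerAr !scalerA mulrC.
- by rewrite mulrDl scalerDr -scalerAl !scalerA mulrC.
- by rewrite linearP scalerDl -scalerA.
Qed.

End VectorField.
End Coalgebra.

(** * Geometric growth of convolution powers *)

Definition geometric_bound (K : numFieldType) (u : nat -> K) : Prop :=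
  exists C M : K, [/\ 0 <= C, 0 <= M & forall n, `|u n| <= C * M ^+ n].

Lemma convpow_recurrence (K : fieldType) (H : algType K) (Hh : hopfAlgebra H)
    (alpha : {linear H -> K^o}) (h : H) :
  exists2 p : {poly K}, p != 0 &
    forall n, \sum_(j < size p) p`_j * convpow Hh alpha (n + j) h = 0.
Proof.
pose s := repr (Delta Hh h); pose k := size s.
pose A := \matrix_(i < k.+1, j < k) convpow Hh alpha i (nth (0, 0) s j).2.
have : kermx A != 0.
  by rewrite -mxrank_eq0 mxrank_ker subn_eq0 -ltnNge ltnS rank_leq_col.
(* [c] is a linear relation between the [iter i (lconv alpha) h], whose
  coordinates on the left tensor factors of [Delta h] are the rows of [A]. *)
case/rowV0Pn => c /sub_kermxP cA c0.
exists (rVpoly c) => [|n].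
  by apply: contra_neq c0 => /(congr1 (poly_rV (d := k.+1))); rewrite rVpolyK linear0.
pose T := lconv Hh alpha.
have Tlin m : linear (iter m T).
  by elim: m => [//|m IH] a x y; rewrite !iterS IH; apply: lconv_linear.
have rel : \sum_(j < k.+1) c 0 j *: iter j T h = 0.
  transitivity (\sum_(j < k.+1) \sum_(i < k)
      (c 0 j * A j i) *: (nth (0, 0) s i).1).
    apply: eq_bigr => j _; rewrite iter_lconv /tsum -/s (big_nth (0, 0)) big_mkord.
    by rewrite scaler_sumr; apply: eq_bigr => i _; rewrite mxE scalerA.
  rewrite exchange_big big1 //= => i _; rewrite -scaler_suml.
  by have /rowP/(_ i) := cA; rewrite !mxE => ->; rewrite scale0r.
transitivity (\sum_(j < k.+1) (rVpoly c)`_j * convpow Hh alpha (n + j) h).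
  rewrite (big_ord_widen _ (fun j => (rVpoly c)`_j * convpow Hh alpha (n + j) h)
    (size_poly _ _)) big_mkcond; apply: eq_bigr => j _; case: ifPn => //.
  by rewrite -leqNgt => /(nth_default 0) ->; rewrite mul0r.
(* Applying [counit] after [n] more iterations turns the relation between the iterates into the
   recurrence at [n]. *)
pose Tl : {linear H -> H} :=
  HB.pack (iter n T) (GRing.isLinear.Build _ _ _ _ (iter n T) (Tlin n)).
pose g : {linear H -> K^o} := counit Hh \o Tl.
transitivity (g (\sum_(j < k.+1) c 0 j *: iter j T h)); last by rewrite rel linear0.
rewrite linear_sum; apply: eq_bigr => j _.
by rewrite linearZ /= -iterD counit_iter_lconv coef_rVpoly_ord.
Qed.

(** Solved for its last term, the recurrence expresses [u n] by the [N] preceding values with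
    coefficients of modulus [c j]. [C] covers the initial values; [M] is at least 1 and at least the
    sum of the [c j], so each step costs at most one factor [M]. *)
Lemma recurrence_geometric_bound (K : numFieldType) (u : nat -> K)
    (p : {poly K}) :
  p != 0 -> (forall n, \sum_(j < size p) p`_j * u (n + j)%N = 0) ->
  geometric_bound u.
Proof.
move=> p0 rec; have l0 : lead_coef p != 0 by rewrite lead_coef_eq0.
have sp : size p = (size p).-1.+1 by rewrite prednK // size_poly_gt0.
set N := (size p).-1 in sp.
pose c j := `|p`_j / lead_coef p|.
pose C := \sum_(j < N) `|u j|; pose M := 1 + \sum_(j < N) c j.
have C0 : 0 <= C by apply: sumr_ge0 => i _; apply: normr_ge0.
have c0 : 0 <= \sum_(j < N) c j by apply: sumr_ge0 => i _; apply: normr_ge0.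
have M1 : 1 <= M by rewrite lerDl.
have M0 : 0 <= M by rewrite addr_ge0.
exists C, M; split => // n; have [m] := ubnP n; elim: m n => // m IH n nm.
have [nN|] := ltnP n N.
  rewrite (le_trans (y := C)) ?ler_peMr ?exprn_ege1 //.
  by rewrite /C (bigD1 (Ordinal nN)) //= lerDl sumr_ge0.
move=> /subnK; set q := (n - N)%N => qn.
have := rec q; rewrite sp big_ord_recr /= => /eqP; rewrite addrC addr_eq0 => /eqP un.
have {un}-> : u n = - \sum_(j < N) p`_j / lead_coef p * u (q + j)%N.
  apply: (mulfI l0); rewrite -[in LHS]qn [LHS]un mulrN mulr_sumr; congr (- _).
  by apply: eq_bigr => j _; rewrite mulrA mulrCA divff // mulr1.
rewrite normrN (le_trans (ler_norm_sum _ _ _)) //.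
(* In degree 0 the sum is empty and [u n = 0]; otherwise [n] is positive and the bound with exponent
   [n.-1] can be used. *)
have [N0|N0] := posnP N.
  by rewrite [X in X <= _]big1 ?mulr_ge0 ?exprn_ge0 // => -[j]; rewrite N0.
rewrite (le_trans (y := \sum_(j < N) c j * (C * M ^+ n.-1))) //.
  apply: ler_sum => j _; rewrite normrM ler_wpM2l //.
  have jn : (q + j <= n.-1)%N.
    by rewrite -qn -subn1 -addnBA // leq_add2l subn1 -ltnS prednK.
  rewrite (le_trans (IH _ _)) ?ler_wpM2l ?ler_weXn2l //.
  by rewrite (leq_ltn_trans jn) // prednK // -qn addn_gt0 N0 orbT.
rewrite -mulr_suml mulrCA ler_wpM2l //.
have n0 : (0 < n)%N by rewrite -qn addn_gt0 N0 orbT.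
rewrite -[in leRHS](prednK n0) exprS ler_wpM2r ?exprn_ge0 //.
by rewrite lerDr.
Qed.

Lemma convpow_geometric_bound (K : numFieldType) (H : algType K)
    (Hh : hopfAlgebra H) (alpha : {linear H -> K^o}) (h : H) :
  geometric_bound (fun n => convpow Hh alpha n h).
Proof.
have [p p0 pP] := convpow_recurrence Hh alpha h.
exact: recurrence_geometric_bound p0 pP.
Qed.

(** * Real exponential generating series *)

Section RealExponentialSeries.
Variable R : realType.
Implicit Types (c : nat -> R) (x : R).

(** Partial sums of the exponential generating function of [c], for which differentiation is the
    shift of [c]. *)
Definition gseries c x : nat -> R := pseries (fun n => c n / n`!%:R) x.
Definition gser c x : R := limn (gseries c x).

Lemma cvg_gseries c x : geometric_bound c -> cvgn (gseries c x).
Proof.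
move=> [C [M [C0 M0 cM]]]; apply: normed_cvg.
apply: (@series_le_cvg _ _ (fun n => C * exp_coeff (M * `|x|) n)) => [n|n|n|].
- exact: normr_ge0.
- by rewrite mulr_ge0 // exp_coeff_ge0 // mulr_ge0.
- rewrite /exp_coeff /= !normrM normrX normfV normr_nat exprMn.
  rewrite [leRHS]mulrA [C * _]mulrA [leRHS]mulrAC ler_wpM2r ?exprn_ge0 //.
  by rewrite ler_wpM2r ?invr_ge0.
- by apply: is_cvg_seriesZ; apply: is_cvg_series_exp_coeff.
Qed.

Lemma geometric_bound_shift c :
  geometric_bound c -> geometric_bound (fun n => c n.+1).
Proof.
move=> [C [M [C0 M0 cM]]]; exists (C * M), M; split; rewrite ?mulr_ge0 //.
by move=> n; rewrite -mulrA -exprS.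
Qed.

Lemma is_derive_gser c x :
  geometric_bound c -> is_derive x 1 (gser c) (gser (fun n => c n.+1) x).
Proof.
have dE d : pseries_diffs (fun n => d n / n`!%:R) = fun n => d n.+1 / n`!%:R :> R.
  apply/funext => n; rewrite /pseries_diffs factS natrM invfM mulrCA.
  by rewrite mulVKf.
move=> cb; have cb1 := geometric_bound_shift cb.
(* Termwise differentiation at [x] asks for convergence of the series and its first two formal
   derivatives at a point beyond [|x|]; [|x| + 1] is one. *)
have := @pseries_snd_diffs _ (fun n => c n / n`!%:R) (`|x| + 1) x.
rewrite !dE; apply.
- exact: cvg_gseries.
- exact: cvg_gseries.
- exact: cvg_gseries (geometric_bound_shift cb1).
- by rewrite [ltRHS]ger0_norm ?addr_ge0 // ltrDl.
Qed.

Lemma derive1_gser c : geometric_bound c ->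
  derive1 (gser c) = gser (fun n => c n.+1).
Proof.
move=> cb; apply/funext => x; rewrite derive1E.
by have [_ ->] := is_derive_gser x cb.
Qed.

Lemma gser_smooth c : geometric_bound c -> rsmooth (gser c).
Proof.
move=> cb n; elim: n c cb => [|n IH] c cb t.
  by have [] := is_derive_gser t cb.
rewrite /derive1n iterSr -/(derive1n _ _) derive1_gser //.
exact: IH _ (geometric_bound_shift cb) t.
Qed.

End RealExponentialSeries.

(** * Complex exponential series of a real variable *)

Section ComplexExponentialSeries.
Variable R : realType.
Implicit Types (u : nat -> R[i]) (x : R).
Local Notation Re := complex.Re.
Local Notation Im := complex.Im.

Lemma cvg_complex (f : nat -> R[i]^o) (a b : R) :
  (fun n => Re (f n)) @ \oo --> a -> (fun n => Im (f n)) @ \oo --> b ->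
  f @ \oo --> (Complex a b : R[i]^o).
Proof.
move=> fa fb; apply/cvgrPdist_lt => e.
rewrite ltcE /= => /andP[/eqP eI e0].
have e2 : 0 < Re e / 2 by rewrite divr_gt0.
move/cvgrPdist_lt/(_ _ e2): fa => fa; move/cvgrPdist_lt/(_ _ e2): fb => fb.
near=> n.
have an : `|a - Re (f n)| < Re e / 2 by near: n.
have bn : `|b - Im (f n)| < Re e / 2 by near: n.
have -> : e = (Re e)%:C%C by case: (e) eI => ? ? /= ->.
rewrite normc_def ltcR.
have -> : Re ((Complex a b : R[i]^o) - f n) = a - Re (f n) by case: (f n).
have -> : Im ((Complex a b : R[i]^o) - f n) = b - Im (f n) by case: (f n).
rewrite [ltRHS]splitr (le_lt_trans _ (ltrD an bn)) //.
(* The modulus is at most the sum of the absolute values of the two components, by comparing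
   squares. *)
rewrite -(ler_pXn2r (n := 2)) ?nnegrE ?sqrtr_ge0 ?addr_ge0 //.
rewrite sqr_sqrtr ?addr_ge0 ?sqr_ge0 // [leRHS]sqrrD !real_normK ?num_real //.
by rewrite lerD2r lerDl mulrn_wge0 // mulr_ge0.
Unshelve. all: by end_near. Qed.

(** Nonnegative elements of [R[i]] are real, so the real parts of the constants serve for both
    components. *)
Lemma geometric_bound_Re_Im u : geometric_bound u ->
  geometric_bound (fun n => Re (u n)) /\ geometric_bound (fun n => Im (u n)).
Proof.
move=> [C [M [C0 M0 uM]]].
have CE : C = (Re C)%:C%C by rewrite RRe_real // ger0_real.
have ME : M = (Re M)%:C%C by rewrite RRe_real // ger0_real.
have {}C0 : 0 <= Re C by rewrite -lecR -CE.
have {}M0 : 0 <= Re M by rewrite -lecR -ME.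
split; exists (Re C), (Re M); split => // n; rewrite -lecR.
  by rewrite rmorphM rmorphXn /= -CE -ME (le_trans (normc_ge_Re _)).
rewrite rmorphM rmorphXn /= -CE -ME; apply: le_trans (uM n).
by rewrite normc_def lecR -sqrtr_sqr ler_wsqrtr // lerDr sqr_ge0.
Qed.

(** Defined by components so that real differentiation applies; [cvg_cser] identifies it with the
    sum of the complex series. *)
Definition cser u x : R[i] :=
  Complex (gser (fun n => Re (u n)) x) (gser (fun n => Im (u n)) x).

Lemma cvg_cser u x : geometric_bound u ->
  series (fun n => x%:C%C ^+ n / n`!%:R * u n : R[i]^o) @ \oo -->
  (cser u x : R[i]^o).
Proof.
move=> /geometric_bound_Re_Im[u1 u2].
have cE n : x%:C%C ^+ n / n`!%:R = (x ^+ n / n`!%:R)%:C%C.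
  by rewrite rmorphM fmorphV rmorphXn rmorph_nat.
apply: cvg_complex.
  rewrite (_ : (fun n => _) = gseries (fun n => Re (u n)) x).
    exact: cvg_gseries.
  apply/funext => n; rewrite /gseries /pseries /series /=.
  rewrite (big_morph (@complex.Re R) (id1 := 0) (op1 := +%R)) //.
    apply: eq_bigr => k _; rewrite cE; case: (u k) => a b /=.
    by rewrite mul0r subr0 mulrC [LHS]mulrA mulrAC.
  by move=> [? ?] [? ?].
rewrite (_ : (fun n => _) = gseries (fun n => Im (u n)) x).
  exact: cvg_gseries.
apply/funext => n; rewrite /gseries /pseries /series /=.
rewrite (big_morph (@complex.Im R) (id1 := 0) (op1 := +%R)) //.
  apply: eq_bigr => k _; rewrite cE; case: (u k) => a b /=.
  by rewrite mul0r addr0 mulrC [LHS]mulrA mulrAC.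
by move=> [? ?] [? ?].
Qed.

(** Partial sums are linear in the coefficient sequence, and limits are unique. *)
Lemma cser_lincomb (I : Type) (s : seq I) (c : I -> R[i])
    (u : I -> nat -> R[i]) (v : nat -> R[i]) x :
  geometric_bound v -> (forall i, geometric_bound (u i)) ->
  (forall n, v n = \sum_(i <- s) c i * u i n) ->
  cser v x = \sum_(i <- s) c i * cser (u i) x.
Proof.
move=> vb ub vE; pose S w : nat -> R[i]^o :=
  series (fun n => x%:C%C ^+ n / n`!%:R * w n : R[i]^o).
apply: (cvg_unique (F := S v @ \oo) (@norm_hausdorff _ R[i]^o)).
  exact: cvg_cser.
have -> : S v = fun n => \sum_(i <- s) c i * S (u i) n.
  apply/funext => n; rewrite /S /series /=.
  under [RHS]eq_bigr do rewrite mulr_sumr.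
  rewrite exchange_big; apply: eq_bigr => k _; rewrite vE mulr_sumr.
  by apply: eq_bigr => i _; rewrite mulrCA.
elim: s {vE} => [|i s IH].
  rewrite big_nil (_ : (fun n => _) = cst 0); first exact: cvg_cst.
  by apply/funext => n; rewrite big_nil.
rewrite big_cons (_ : (fun n => _) =
    (fun n => c i * S (u i) n) + fun n => \sum_(i <- s) c i * S (u i) n).
  apply: cvgD IH; apply: (@cvgMl_tmp R[i]); exact: cvg_cser.
by apply/funext => n; rewrite big_cons.
Qed.

Lemma cser_smooth u : geometric_bound u -> cser u \in @csmooth_pred R.
Proof.
move=> /geometric_bound_Re_Im[u1 u2].
by apply/asboolP; split; apply: gser_smooth.
Qed.

Lemma deriv_cser u (ub : geometric_bound u) x :
  Defs.deriv (CSmooth (cser_smooth ub)) x = cser (fun n => u n.+1) x.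
Proof.
have [u1 u2] := geometric_bound_Re_Im ub.
by rewrite /= /deriv_fun /= !derive1_gser.
Qed.

End ComplexExponentialSeries.

(** * Curves with zero derivative *)

Section ConstantCurves.
Variables (R : realType) (H : lmodType R[i]).

Lemma csmooth_deriv0 (a : csmooth R) :
  (forall t, Defs.deriv a t = 0) -> forall t, a t = a 0.
Proof.
move=> a0 t; have [sR sI] := csmoothP a.
have cst f : rsmooth f -> (forall x, derive1 f x = 0) -> f t = f 0 :> R.
  move=> sf f0; apply: is_derive_0_is_cst => x.
  by apply: DeriveDef; [exact: sf 0%N x|rewrite -derive1E].
have := cst _ sR (fun x => congr1 (@complex.Re R) (a0 x)).
have := cst _ sI (fun x => congr1 (@complex.Im R) (a0 x)).
by case: (a t) (a 0) => ? ? [? ?] /= -> ->.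
Qed.

(* In a presentation of minimal length the vectors are linearly independent,
  so that all coefficients have zero derivative. *)
Lemma dot0_constant (m : curve H) :
  (forall t, dot m t = 0) -> forall t, m t = m 0.
Proof.
move=> m0; pose P n := `[< exists2 s, size s = n & forall t, m t = scurve s t >].
have exP : exists n, P n.
  by have [s sm] := curveP m; exists (size s); apply/asboolP; exists s.
case: (ex_minnP exP) => n /asboolP[s sn sm] nmin t.
rewrite !sm /scurve big_seq [RHS]big_seq; apply: eq_bigr => -[a v] av /=.
congr (_ *: _); move: t; apply: csmooth_deriv0 => t.
apply/eqP/negPn/negP => at0.
(* Dividing [dot m t = 0] by the nonzero derivative of [a] expresses [v] by the other vectors;
   absorbing its term into theirs gives a shorter presentation of [m]. *)
pose c (p : csmooth R * H) := - (Defs.deriv a t)^-1 * Defs.deriv p.1 t.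
have vE : v = \sum_(p <- rem (a, v) s) c p *: p.2.
  have := m0 t; rewrite (dotE sm) /scurve big_map (big_rem _ av) /= => /eqP.
  rewrite addr_eq0 => /eqP /(congr1 ( *:%R (Defs.deriv a t)^-1)).
  rewrite scalerA mulVf // scale1r => vE; rewrite [LHS]vE scalerN -scaleNr scaler_sumr.
  by apply: eq_bigr => p _; rewrite scalerA.
suff Pn : P (size s).-1.
  by have := nmin _ Pn; rewrite -sn leqNgt ltn_predL; case: (s) av.
apply/asboolP; exists [seq (p.1 + a * csmooth_cst (c p), p.2) | p <- rem (a, v) s].
  by rewrite size_map size_rem.
move=> x; rewrite sm /scurve big_map (big_rem _ av) /= [X in _ *: X + _]vE.
rewrite scaler_sumr -big_split; apply: eq_bigr => p _ /=.
by rewrite scalerA -scalerDl addrC.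
Qed.

End ConstantCurves.

(** * The flow of the operator [A] *)

Section Flow.
Variables (R : realType) (H : algType R[i]) (Hh : hopfAlgebra H).
Local Notation Delta := (Delta Hh).

Section Functional.
Variable alpha : {linear H -> R[i]^o}.
Local Notation A := (lconv Hh alpha).

Definition cexp h : csmooth R :=
  CSmooth (cser_smooth (convpow_geometric_bound Hh alpha h)).

Lemma cvg_conv_exp_series x h :
  conv_exp_series Hh x%:C%C alpha h @ \oo --> (cexp h x : R[i]^o).
Proof. exact: cvg_cser (convpow_geometric_bound Hh alpha h). Qed.

Arguments cvg_conv_exp_series : clear implicits.

Lemma conv_expE x h : conv_exp Hh x%:C%C alpha h = cexp h x.
Proof.
have := cvg_lim (@norm_hausdorff _ R[i]^o) (cvg_conv_exp_series x h).
by apply.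
Qed.

Lemma cexp_linear x : linear (fun h => cexp h x : R[i]^o).
Proof.
move=> c h k.
rewrite /= (@cser_lincomb _ _ [:: (c, h); (1, k)] fst
  (fun p n => convpow Hh alpha n p.2)); first 1 last.
- exact: convpow_geometric_bound.
- by move=> p; apply: convpow_geometric_bound.
- by move=> n; rewrite !big_cons big_nil /= addr0 mul1r convpow_linear.
by rewrite !big_cons big_nil /= addr0 mul1r.
Qed.

Lemma deriv_cexp h x : Defs.deriv (cexp h) x = cexp (A h) x.
Proof.
rewrite deriv_cser /cexp /=; congr (cser _ x).
by apply/funext => n; apply: convpowSr.
Qed.

(** The left side is [exp] times [alpha], the right side [alpha] times [exp]: a functional commutes
    with its exponential. *)
Lemma cexp_lconv h x :
  cexp (A h) x = tsum (W := R[i]^o) (fun a b => alpha a * cexp b x) (Delta h).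
Proof.
rewrite /= (@cser_lincomb _ _ (repr (Delta h)) (fun p => alpha p.1)
  (fun p n => convpow Hh alpha n p.2)) //.
- exact: convpow_geometric_bound.
- by move=> p; apply: convpow_geometric_bound.
- by move=> n; rewrite -convpowSr.
Qed.

Lemma cexp0 h : cexp h 0 = counit Hh h.
Proof.
apply: (cvg_unique (F := conv_exp_series Hh 0%:C%C alpha h @ \oo)
  (@norm_hausdorff _ R[i]^o)); first exact: cvg_conv_exp_series.
(* Partial sum 0 is empty; from index 1 on only the term with [0 ^+ 0 = 1] survives. *)
apply: cvg_near_cst; exists 1%N => // n /= n0.
rewrite /conv_exp_series /series /= big_ltn // big_nat big1 ?addr0.
  by rewrite expr0 fact0 invr1 !mul1r.
by move=> k /andP[k0 _]; rewrite expr0n gtn_eqF // !mul0r.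
Qed.


(** This is [e^(xA)], given by the closed formula instead of a series of operators because [H]
    carries no topology. *)
Definition flow x h : H := tsum (fun a b => cexp b x *: a) (Delta h).

Lemma flow_linear x : linear (flow x).
Proof.
move=> c h k; rewrite /flow linearP tsum_linear //.
split=> [v d a b|a d u v]; first by rewrite scalerDr !scalerA mulrC.
by rewrite cexp_linear scalerDl scalerA.
Qed.

Lemma flow0 h : flow 0 h = h.
Proof.
by rewrite -[RHS](Delta_counitr Hh); apply: eq_tsum => a b; rewrite cexp0.
Qed.

(** By [deriv_cexp], the right side is the termwise derivative in [x] of [flow x h]. *)
Lemma flow_lconv x h :
  flow x (A h) = tsum (fun a b => cexp (A b) x *: a) (Delta h).
Proof.
rewrite {2}/lconv linear_tsum; last exact: flow_linear.
transitivity (tsum (fun a b => tsum (fun a1 a2 =>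
    (alpha b * cexp a2 x) *: a1) (Delta a)) (Delta h)).
  apply: eq_tsum => a b; rewrite (is_linearZ (flow_linear x)) /flow /tsum scaler_sumr.
  by apply: eq_bigr => p _; rewrite scalerA.
rewrite (@tsum_coassoc _ _ _ _ (fun a1 a2 b => (alpha b * cexp a2 x) *: a1)).
  apply: eq_tsum => a b; rewrite /tsum -scaler_suml; congr (_ *: _).
  rewrite [RHS](linear_tsum (fun a b => alpha b *: a) _ (cexp_linear x)).
  by apply: eq_bigr => p _; rewrite (is_linearZ (cexp_linear x)).
split=> [b c|a c|a b] d u v.
- by rewrite scalerDr !scalerA mulrC.
- by rewrite cexp_linear mulrDr scalerDl scalerA mulrCA.
- by rewrite linearP mulrDl scalerDl scalerA mulrA.
Qed.

(** Coassociativity gives [h_(1) (alpha exp)(h_(2))] on one side and [h_(1) (exp alpha)(h_(2))] on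
    the other; [cexp_lconv] equates them. *)
Lemma lconv_flow x h : A (flow x h) = flow x (A h).
Proof.
rewrite flow_lconv {1}/flow linear_tsum; last exact: lconv_linear.
transitivity (tsum (fun a b => tsum (fun a1 a2 =>
    (alpha a2 * cexp b x) *: a1) (Delta a)) (Delta h)).
  apply: eq_tsum => a b; rewrite (is_linearZ (@lconv_linear _ _ _ _)) /lconv /tsum.
  by rewrite scaler_sumr; apply: eq_bigr => p _; rewrite scalerA mulrC.
rewrite (@tsum_coassoc _ _ _ _ (fun a1 a2 b => (alpha a2 * cexp b x) *: a1)).
  by apply: eq_tsum => a b; rewrite /tsum -scaler_suml cexp_lconv.
split=> [b c|a c|a b] d u v.
- by rewrite scalerDr !scalerA mulrC.
- by rewrite linearP mulrDl scalerDl scalerA mulrA.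
- by rewrite cexp_linear mulrDr scalerDl scalerA mulrCA.
Qed.

Definition flowc h : curve H :=
  Curve (scurve_subproof [seq (cexp p.2, p.1) | p <- repr (Delta h)]).

Lemma flowcE h x : flowc h x = flow x h.
Proof. by rewrite /= /scurve big_map. Qed.

Lemma dot_flowc h x : dot (flowc h) x = flow x (A h).
Proof.
rewrite (@dotE _ _ _ [seq (cexp p.2, p.1) | p <- repr (Delta h)]) //.
rewrite flow_lconv /scurve /dscurve -map_comp big_map.
by apply: eq_bigr => p _; rewrite deriv_cexp.
Qed.

(** The curve [x |-> e^(xA) (scurve s x)], built termwise so that its derivative follows from the
    product rule [dotZ]. *)
Definition pflow (s : seq (csmooth R * H)) : curve H :=
  \sum_(p <- s) (p.1 *: flowc p.2).

Lemma curve_sumE (I : Type) (s : seq I) (f : I -> curve H) x :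
  (\sum_(i <- s) f i) x = \sum_(i <- s) f i x.
Proof. by elim/big_rec2: _ => // i y z _ <-. Qed.

Lemma pflowE s x : pflow s x = flow x (scurve s x).
Proof.
rewrite /pflow curve_sumE /scurve.
elim: s => [|p s IH].
  by rewrite !big_nil (is_linear0 (flow_linear x)).
rewrite !big_cons flow_linear IH; congr (_ + _).
by rewrite -flowcE.
Qed.

Lemma dot_pflow s x :
  dot (pflow s) x = flow x (scurve (dscurve s) x + A (scurve s x)).
Proof.
rewrite /pflow; elim: s => [|p s IH].
  rewrite /scurve !big_nil (is_linear0 (@lconv_linear _ _ _ _)) addr0.
  by rewrite (is_linear0 (flow_linear x)) (@dotE _ _ _ [::]) /scurve ?big_nil // => t;
    rewrite big_nil.
have consE q r : scurve (q :: r) x = q.1 x *: q.2 + scurve r x.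
  by rewrite /scurve big_cons.
rewrite big_cons dotD curveD IH dotZ curveD.
rewrite [dscurve _]/= -/(dscurve s) !consE /= lconv_linear addrACA.
rewrite [RHS](is_linearD (flow_linear x)); congr (_ + _).
rewrite (is_linearD (flow_linear x)) !(is_linearZ (flow_linear x)).
by rewrite -dot_flowc -flowcE.
Qed.

(* [t |-> e^(tA) (m t)] has zero derivative. *)
Lemma flow_cancel_solution (m : curve H) :
  (forall x, dot m x = - A (m x)) -> forall x, flow x (m x) = m 0.
Proof.
move=> mE x; have [s sm] := curveP m.
rewrite sm -pflowE (@dot0_constant _ _ (pflow s)) ?pflowE ?flow0 ?sm // => t.
rewrite dot_pflow -(dotE sm) -sm mE addNr.
by rewrite (is_linear0 (flow_linear t)).
Qed.

End Functional.

End Flow.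

(** * Change of sign and invertibility of the flow *)

Section OppositeFunctional.
Variables (R : realType) (H : algType R[i]) (Hh : hopfAlgebra H).
Variable alpha : {linear H -> R[i]^o}.
Local Notation opp_alpha := (\- alpha : {linear H -> R[i]^o}).

Lemma lconv_opp h : lconv Hh opp_alpha h = - lconv Hh alpha h.
Proof. by rewrite /lconv /tsum -sumrN; apply: eq_bigr => p _; rewrite scaleNr. Qed.

Lemma convpow_opp n h :
  convpow Hh opp_alpha n h = (- 1) ^+ n * convpow Hh alpha n h.
Proof.
elim: n h => [|n IH] h; first by rewrite mul1r.
rewrite /convpow !iterS -!/(convpow _ _ n) /Defs.conv /tsum mulr_sumr.
by apply: eq_bigr => p _; rewrite IH exprS mulN1r !mulNr mulrCA.
Qed.

Lemma conv_exp_series_opp z h :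
  conv_exp_series Hh z opp_alpha h = conv_exp_series Hh (- z) alpha h.
Proof.
apply/funext => n; rewrite /conv_exp_series /series /=.
by apply: eq_bigr => k _; rewrite convpow_opp [(- z) ^+ _]exprNn [LHS]mulrCA !mulrA.
Qed.

(** No power series are multiplied: [x |-> e^(xA) h] solves the equation belonging to [- alpha], so
    [flow_cancel_solution] applies to it. *)
Lemma flow_opp x h : flow Hh opp_alpha x (flow Hh alpha x h) = h.
Proof.
rewrite -[flow Hh alpha x h]flowcE flow_cancel_solution ?flowcE ?flow0 // => t.
by rewrite dot_flowc lconv_opp opprK flowcE lconv_flow.
Qed.

End OppositeFunctional.

(** * The equation of the connection and its solutions *)

(** The module action [a (x) v |-> a v] sends [dt (x) v] to [v], so [dt (x) v] vanishes only with
    [v]. *)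
Lemma nablaM_eq0 (R : realType) (H : algType R[i]) (Omega : lmodType R[i])
    (calc : fodc H Omega) (X : rightVectorField calc) (m : curve H) :
  nablaM X m = 0 <-> dot m = - Xd X m.
Proof.
have B : bilinear_map (fun (a : (csmooth R)^o) (v : curve H) => a *: v).
  split=> [v c a b|a c v w] /=; first by rewrite scalerDl scalerA.
  by rewrite scalerDr !scalerA mulrC.
split=> [/(congr1 (tsum (fun (a : (csmooth R)^o) v => a *: v)))|mE].
  rewrite (is_linear0 (tsum_linear B)) tsum_tens // scale1r => /eqP.
  by rewrite addr_eq0 => /eqP.
by rewrite /nablaM mE addNr -(scale0r 0) tensZr scale0r.
Qed.

Unset Implicit Arguments.

Theorem theorem3p4 (R : realType) (H : algType R[i]) (Hh : hopfAlgebra H)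
    (Sinv : H -> H)
    (antipodeK : cancel (antipode Hh) Sinv)
    (SinvK : cancel Sinv (antipode Hh))
    (Omega : lmodType R[i]) (calc : fodc H Omega)
    (cov : leftCovariant Hh calc)
    (X : rightVectorField calc) (X_inv : left_invariant cov X) :
  (forall m : curve H, nablaM X m = 0 <-> dot m = - Xd X m) /\
  (forall (t : R) (h : H),
     cvgn (conv_exp_series Hh (- t)%:C%C (X_omega Hh Sinv X) h)) /\
  (forall m0 : H, exists m : curve H,
     [/\ m 0 = m0,
         nablaM X m = 0,
         forall t : R,
           m t = tsum (fun a b =>
                   conv_exp Hh (- t)%:C%C (X_omega Hh Sinv X) b *: a)
                 (Delta Hh m0)
       & forall m' : curve H, m' 0 = m0 -> nablaM X m' = 0 -> m' = m]).
Proof.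
pose chi := vf_functional Hh X.
have -> : X_omega Hh Sinv X = chi.
  by apply/funext => h; apply: (X_omegaE X_inv).
(* The sign of [- t] is moved into the functional, so that the solution is the flow of [beta] at
   [t]. *)
pose beta : {linear H -> R[i]^o} := \- chi.
have XdE (m : curve H) t : Xd X m t = lconv Hh chi (m t).
  exact: (vf_lconv X_inv).
split; first exact: nablaM_eq0.
split=> [t h|m0].
  by apply/cvg_ex; exists (cexp Hh chi h (- t)); apply: cvg_conv_exp_series.
exists (flowc Hh beta m0); split.
- by rewrite flowcE flow0.
- apply/nablaM_eq0/curve_eq => t.
  by rewrite dot_flowc -lconv_flow lconv_opp -flowcE -XdE.
- move=> t; rewrite flowcE; apply: eq_tsum => a b; congr (_ *: _).
  by rewrite -conv_expE /conv_exp conv_exp_series_opp -rmorphN.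
(* Uniqueness: the flow of [chi] sends [m t] back to [m 0], and the flow of [beta] inverts it. *)
- move=> m m00 /nablaM_eq0 mE; apply: curve_eq => t.
  rewrite flowcE -m00 -(@flow_cancel_solution _ _ Hh chi m _ t).
    by rewrite flow_opp.
  by move=> x; rewrite mE -XdE.
Qed.
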